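(* (a) Let $D=\{\lambda\in\mathbb{C} \mid \mathrm{Re}\,\lambda\geq 0,\ |\lambda|\leq 1\}$. If $\lambda\in D$, then $Z_G(\lambda)\neq 0$ for any graph $G$ with maximum degree $3$. (b) Let $\Delta\geq 3$. Let $$D_1=\left\{\lambda\in\mathbb{C} \ \middle|\ \mathrm{Re}\,\lambda\geq 0,\ |\lambda|\leq \tfrac{7}{8}\tan\left(\tfrac{\pi}{2(\Delta-1)}\right)\right\}$$ and $$D_2=\left\{\lambda\in\mathbb{C} \ \middle|\ \mathrm{Re}\,\lambda\geq 0,\ |\lambda|\leq \tan\left(\tfrac{\pi}{2(\Delta-1)}\right)\right\}.$$ There exists an open domain $D\subseteq\mathbb{C}$ with the following properties: (1) if $\lambda\in D$ then $Z_G(\lambda)\neq 0$ for any graph $G$ with maximum degree $\Delta$; (2) $D_1\subseteq D\subseteq D_2$; (3) $D_{PR}\subset D$; (4) $\tan\left(\frac{\pi}{2(\Delta-1)}\right),\ \pm i\tan\left(\frac{\pi}{2(\Delta-1)}\right)\in D$.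
   Context: Graphs are finite and simple, and $\Delta$ is an integer. The independence polynomial of a graph $G$ is $Z_G(\lambda)=\sum_{k\geq 0} i_k(G)\lambda^k$, where $i_k(G)$ is the number of independent sets of size $k$ in $G$ (so $i_0(G)=1$). For the given $\Delta$ and for $\varepsilon>0$ let $$D_\varepsilon=\left\{\lambda\in\mathbb{C}\ \middle|\ |\lambda|\leq \tan\left(\frac{\pi}{(2+\varepsilon)(\Delta-1)}\right)\ \text{and}\ |\arg(\lambda)|\leq \frac{\varepsilon\pi}{2(2+\varepsilon)}\right\},$$ and set $D_{PR}=\bigcup_{\varepsilon>0} D_\varepsilon$.
   Formalization: No set D open in ℂ can satisfy D_1 ⊆ D ⊆ D_2, since 0 ∈ D_1 lies on the boundary of D_2; so ''open domain'' is read as a connected set that is open relative to D_2. *)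

(* Defs.v *)
From HB Require Import structures.
From mathcomp Require Import all_boot all_order all_algebra.
From mathcomp Require Import complex.
From mathcomp Require Import all_classical all_reals all_analysis.
Set Implicit Arguments.
Unset Strict Implicit.
Unset Printing Implicit Defensive.
Import Order.TTheory GRing.Theory Num.Theory.
Import numFieldNormedType.Exports.
Local Open Scope classical_set_scope.
Local Open Scope ring_scope.

(* Finite simple graphs are symmetric irreflexive relations on a finType. *)
Record sgraph := SGraph {
  vertex :> finType;
  adj : rel vertex;
  adj_sym : symmetric adj;
  adj_irr : irreflexive adj }.

Definition max_degree (G : sgraph) : nat :=
  \max_(x : G) #|[set y : G | adj x y]%SET|.

Definition independent (G : sgraph) (A : {set G}) : bool :=
  [forall x in A, forall y in A, ~~ adj x y].

Definition num_indep (G : sgraph) (k : nat) : nat :=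
  #|[set A : {set G} | independent A & #|A| == k]%SET|.

(* No independent set has more than #|G| vertices. *)
Definition indep_poly (F : nzRingType) (G : sgraph) : {poly F} :=
  \poly_(k < #|G|.+1) (num_indep G k)%:R.

Section Complex.
Variable R : realType.
Implicit Types (l : R[i]) (d : nat) (eps r : R).

Definition zero_free d l : Prop :=
  forall G : sgraph, max_degree G = d -> (indep_poly R[i] G).[l] != 0.

(* Principal argument, with values in ]-pi, pi] and the convention arg 0 = 0. *)
Definition carg l : R :=
  if l == 0 then 0 else
  let a := acos (complex.Re l / complex.Re `|l|) in
  if 0 <= complex.Im l then a else - a.

(* The norm of R[i] takes values in R[i], hence the cast of real bounds. *)
Definition half_disk r : set R[i] :=
  [set l | 0 <= complex.Re l /\ `|l| <= r%:C%C].

Definition D_eps d eps : set R[i] :=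
  [set l | `|l| <= (tan (pi / ((2 + eps) * (d%:R - 1))))%:C%C /\
           `|carg l| <= eps * pi / (2 * (2 + eps))].

Definition D_PR d : set R[i] := \bigcup_(eps in [set e : R | 0 < e]) D_eps d eps.

(* D is a domain (connected open set) relative to E, i.e. for the topology that
   E inherits from the complex plane. *)
Definition domain_in (E D : set R[i]) : Prop :=
  (exists2 U : set R[i]^o, open U & D = U `&` E) /\ connected (D : set R[i]^o).

End Complex.

(* Main.v *)
Require Import Defs.
From HB Require Import structures.
From mathcomp Require Import all_boot all_order all_algebra.
From mathcomp Require Import complex.
From mathcomp Require Import all_classical all_reals all_analysis.
From mathcomp Require Import ring lra.
Import Order.TTheory GRing.Theory Num.Theory.
Import numFieldNormedType.Exports.
Local Open Scope classical_set_scope.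
Local Open Scope ring_scope.

(* Put d = Delta - 1. The ratios R_v = l Z(G - N[v]) / Z(G - v) satisfy
   R = l / prod (1 + R_i) over at most d children, so it is enough to find a set
   S of complex numbers of real part > -1/2 that is stable under this recursion.
   Write l = r cis a, with 0 <= a <= pi/2 by conjugation.
   - Delta = 3, r <= 1: S is the set of all z with |z| <= 1 and
     a - pi/2 <= arg z <= pi/2. For such z, arg (1 + z) >= - (pi/2 - a)/2,
     because arg (1 + cis th) = th/2.
   - In general S is given by |z| <= r, -b <= arg z <= pi/2 and Im z <= Im l. It
     is stable if 0 <= b <= a, d r sin a <= a + b and a + d r sin b <= pi/2.
     This covers r <= (7/8) tan (pi/2d), and also all r <= tan (pi/2d) when l is
     close enough to the real axis.
   - Near the imaginary axis, S consists of l and of the points of a slightly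
     enlarged quadrant of modulus bounded away from both 0 and r.
   The domain D is then the part of the half-disk D2 covered by the last two
   cases (all of D2 when Delta = 3); it is star-shaped about 0. *)

Set Implicit Arguments.
Unset Strict Implicit.

Definition nbhd (G : sgraph) (v : G) : {set G} := [set y : G | adj v y]%SET.

Definition indep_sum (F : comNzRingType) (l : F) (G : sgraph) (A : {set G}) : F :=
  \sum_(I : {set G} | (I \subset A) && independent I) l ^+ #|I|.

Lemma indep_sum0 (F : comNzRingType) (l : F) (G : sgraph) :
  indep_sum l (finset.set0 : {set G}) = 1.
Proof.
rewrite /indep_sum (big_pred1 finset.set0) ?cards0 ?expr0// => I /=.
rewrite finset.subset0; case: eqP => [->|//] /=.
by apply/forall_inP => x; rewrite inE.
Qed.

Lemma indepP (G : sgraph) (I : {set G}) :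
  reflect {in I &, forall x y, ~~ adj x y} (independent I).
Proof.
apply: (iffP forall_inP) => [H x y xI yI|H x xI].
  by move/forall_inP: (H x xI) => /(_ y yI).
by apply/forall_inP => y yI; exact: H.
Qed.

Lemma indep_sum_rec (F : comNzRingType) (l : F) (G : sgraph) (A : {set G}) (v : G) :
  v \in A ->
  indep_sum l A =
  indep_sum l (A :\ v)%SET + l * indep_sum l (A :\ v :\: nbhd v)%SET.
Proof.
move=> vA; rewrite /indep_sum (bigID (fun I : {set G} => v \notin I)) /=.
congr (_ + _).
  apply: eq_bigl => I; rewrite finset.subsetD1.
  by rewrite -!andbA; congr andb; rewrite andbC.
rewrite big_distrr /=.
rewrite (reindex_onto (fun I => v |: I)%SET (fun I => I :\ v)%SET) /=; last first.
  by move=> I /andP[_]; rewrite negbK => vI; rewrite finset.setD1K.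
apply: eq_big => [I|I]; last first.
  case/andP => _ /eqP eI; have vI : v \notin I by rewrite -eI finset.setD11.
  by rewrite cardsU1 vI exprS.
apply/idP/idP.
  case/andP => /andP[/andP[sA iI] _] /eqP eI.
  have vI : v \notin I by rewrite -eI finset.setD11.
  move/indepP: iI => iI; apply/andP; split.
    apply/fintype.subsetP => x xI; rewrite !inE.
    have xv : x != v by apply: contraNneq vI => <-.
    rewrite xv (fintype.subsetP sA) ?inE ?xI ?orbT// andbT.
    by rewrite andbT; apply: iI; rewrite !inE ?eqxx ?xI ?orbT.
  by apply/indepP => x y xI yI; apply: iI; rewrite !inE ?xI ?yI orbT.
case/andP => /fintype.subsetP sI /indepP iI.
have vI : v \notin I by apply/negP => /sI; rewrite !inE eqxx andbF.
rewrite finset.setU1K // eqxx setU11 /= !andbT; apply/andP; split.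
  apply/fintype.subsetP => x; rewrite !inE => /orP[/eqP->//|/sI].
  by rewrite !inE => /and3P[].
apply/indepP => x y; rewrite !inE => /orP[/eqP->|xI] /orP[/eqP->|yI].
- by rewrite adj_irr.
- by have := sI _ yI; rewrite !inE => /andP[].
- by have := sI _ xI; rewrite !inE => /andP[]; rewrite adj_sym.
- exact: iI.
Qed.

Lemma horner_indep_poly (F : comNzRingType) (l : F) (G : sgraph) :
  (indep_poly F G).[l] = indep_sum l (finset.setT : {set G}).
Proof.
rewrite /indep_poly horner_poly /indep_sum.
rewrite (partition_big (fun I : {set G} => inord #|I| : 'I_(#|G|.+1)) xpredT) //=.
apply: eq_bigr => k _; rewrite /num_indep cardsE -sum1_card natr_sum big_distrl /=.
apply: eq_big => [I|I /andP[_ /eqP->]]; last by rewrite mul1r.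
rewrite finset.subsetT /=; congr andb.
by rewrite -val_eqE /= inordK ?ltnS ?max_card.
Qed.

(* The ratios l Z(A \ N[v]) / Z(A \ v) at vertices v with at most d neighbours
   in A stay in S; a vertex with d + 1 neighbours is split off last, as
   1 + l / prod (1 + z_i) with d + 1 factors vanishes only if 1 + z + w = 0 for
   some z, w in S. *)
Section InvariantRegion.
Variables (F : fieldType) (l : F) (d : nat) (S : F -> Prop).
Hypothesis S_step : forall zs : seq F, (size zs <= d)%N ->
  (forall z, z \in zs -> S z) -> S (l / \prod_(z <- zs) (1 + z)).
Hypothesis S_neq0 : forall z, S z -> 1 + z != 0.
Hypothesis S_neq0_2 : forall z w, S z -> S w -> 1 + z + w != 0.
Variable G : sgraph.
Hypothesis degG : (max_degree G <= d.+1)%N.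

Let Z (A : {set G}) : F := indep_sum l A.
Let ratio (A : {set G}) (v : G) : F := l * Z (A :\ v :\: nbhd v)%SET / Z (A :\ v)%SET.

Let good (A : {set G}) := Z A != 0 /\
  forall v, v \in A -> (#|nbhd v :&: A|%SET <= d)%N -> S (ratio A v).

Lemma deg_le (v : G) : (#|nbhd v| <= d.+1)%N.
Proof. by apply: leq_trans degG; exact: (@leq_bigmax _ (fun x : G => #|nbhd x|) v). Qed.

Lemma prod_ratios (us : seq G) (B : {set G}) : uniq us -> {subset us <= B} ->
  {in us, forall u, exists2 v, v \in nbhd u & v \notin B} ->
  (forall A : {set G}, A \subset B -> good A) ->
  exists zs : seq F, [/\ size zs = size us, (forall z, z \in zs -> S z) &
    Z B = Z (B :\: [set x in us])%SET * \prod_(z <- zs) (1 + z)].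
Proof.
elim: us B => [|u us IH] B /=.
  move=> _ _ _ _; exists [::]; split=> //; rewrite big_nil mulr1.
  by congr Z; apply/setP => x; rewrite !inE.
case/andP => uus uniq_us sB deg gB.
have uB : u \in B by apply: sB; rewrite inE eqxx.
have [||||zs [szs Szs eZ]] := IH (B :\ u)%SET => //.
- move=> x xus; rewrite !inE sB ?inE ?xus ?orbT// andbT.
  by apply: contraNneq uus => <-.
- move=> x xus; have [|v v1 v2] := deg x; first by rewrite inE xus orbT.
  by exists v => //; rewrite !inE negb_and v2 orbT.
- by move=> A /fintype.subset_trans sA; apply: gB; apply: sA; exact: finset.subD1set.
exists (ratio B u :: zs); split => /=; first by rewrite szs.
  move=> z; rewrite inE => /orP[/eqP->|/Szs//].
  have [_ +] := gB _ (fintype.subxx B); apply=> //.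
  have [|v v1 v2] := deg u; first by rewrite inE eqxx.
  rewrite -ltnS; apply: leq_trans (deg_le u); apply: proper_card.
  apply/properP; split; first exact: finset.subsetIl.
  by exists v => //; rewrite inE negb_and v2 orbT.
have nz : Z (B :\ u)%SET != 0 by have [] := gB _ (finset.subD1set B u).
have -> : Z B = Z (B :\ u)%SET * (1 + ratio B u).
  rewrite /Z (@indep_sum_rec _ _ _ _ u) // -/(Z _) -/(Z _) mulrDr mulr1 /ratio.
  by rewrite mulrCA divff // mulr1.
rewrite eZ big_cons -mulrA; congr (Z _ * _); last by rewrite mulrC.
by apply/setP => x; rewrite !inE negb_or; rewrite andbCA andbA.
Qed.

Lemma good_all (A : {set G}) : good A.
Proof.
have [n] := ubnP #|A|; elim: n A => // n IH A /ltnSE cA.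
have gsub (v : G) (B : {set G}) : v \in A -> B \subset (A :\ v)%SET -> good B.
  move=> vA sB; apply: IH; apply: leq_trans cA.
  by apply: leq_ltn_trans (subset_leq_card sB) _; rewrite (cardsD1 v A) vA.
have expand (v : G) : v \in A -> exists zs : seq F,
    [/\ size zs = #|nbhd v :&: A|%SET, (forall z, z \in zs -> S z) &
    Z (A :\ v)%SET = Z (A :\ v :\: nbhd v)%SET * \prod_(z <- zs) (1 + z)].
  move=> vA.
  have [||||zs [s1 s2 s3]] := @prod_ratios (enum (nbhd v :&: A)%SET) (A :\ v)%SET.
  - exact: enum_uniq.
  - move=> x; rewrite mem_enum !inE => /andP[vx ->]; rewrite andbT.
    by apply: contraTneq vx => ->; rewrite adj_irr.
  - move=> x; rewrite mem_enum !inE => /andP[vx _]; exists v.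
      by rewrite inE adj_sym.
    by rewrite !inE eqxx.
  - by move=> B; apply: gsub.
  exists zs; split => //; first by rewrite s1 -cardE.
  rewrite s3; congr (Z _ * _); apply/setP => x; rewrite !inE mem_enum !inE.
  by case: (x \in A); rewrite ?andbF ?andbT.
have Zn (v : G) : v \in A -> Z (A :\ v :\: nbhd v)%SET != 0.
  by move=> vA; have [] // := gsub v _ vA (finset.subsetDl _ (nbhd v)).
have Sratio v : v \in A -> (#|nbhd v :&: A|%SET <= d)%N -> S (ratio A v).
  move=> vA dv; have [zs [szs Szs eZ]] := expand v vA.
  by rewrite /ratio eZ invfM mulrA mulfK ?Zn //; apply: S_step; rewrite ?szs.
split=> //.
have [->|[v vA]] := finset.set_0Vmem A; first by rewrite /Z indep_sum0 oner_neq0.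
have [le_d|gt_d] := leqP #|nbhd v :&: A|%SET d.
  have nz : Z (A :\ v)%SET != 0 by have [] := gsub v _ vA (fintype.subxx _).
  have -> : Z A = Z (A :\ v)%SET * (1 + ratio A v).
    rewrite /Z (@indep_sum_rec _ _ _ _ v) // -/(Z _) -/(Z _) mulrDr mulr1 /ratio.
    by rewrite mulrCA divff // mulr1.
  by apply: mulf_neq0 => //; apply: S_neq0; exact: Sratio.
have [zs [szs Szs eZ]] := expand v vA.
rewrite /Z (@indep_sum_rec _ _ _ _ v) // -/(Z _) -/(Z _) eZ [l * _]mulrC -mulrDr.
apply: mulf_neq0; first exact: Zn.
case: zs szs Szs eZ => [|z zs] szs Szs eZ; first by rewrite -szs in gt_d.
have szs' : (size zs <= d)%N.
  rewrite -ltnS -[(size zs).+1]/(size (z :: zs)) szs.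
  by apply: leq_trans (deg_le v); apply: subset_leq_card; exact: finset.subsetIl.
have Sz x : x \in zs -> S x by move=> xz; apply: Szs; rewrite inE xz orbT.
have p_neq0 : \prod_(x <- zs) (1 + x) != 0.
  by rewrite prodf_seq_neq0; apply/allP => x /Sz /S_neq0 ->.
rewrite big_cons.
have -> : (1 + z) * \prod_(x <- zs) (1 + x) + l =
   (1 + z + l / \prod_(x <- zs) (1 + x)) * \prod_(x <- zs) (1 + x).
  by rewrite [RHS]mulrDl divfK.
apply: mulf_neq0 => //; apply: S_neq0_2; last exact: S_step.
by apply: Szs; rewrite inE eqxx.
Qed.

Lemma invariant_region_zero_free : (indep_poly F G).[l] != 0.
Proof. by rewrite horner_indep_poly; have [] := good_all finset.setT. Qed.

End InvariantRegion.

Section RealBounds.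
Variable R : realType.
Implicit Types (x y u s q a b r : R).

Lemma derive_ge0_le (f f' : R -> R) : (forall x, is_derive x (1 : R) f (f' x)) ->
  (forall x, 0 < x -> 0 <= f' x) -> forall x, 0 <= x -> f 0 <= f x.
Proof.
move=> df f'0 x x0; apply: (@ger0_derive1_ndecr _ f 0 x) => //.
- by move=> y; rewrite in_itv /= => /andP[/f'0 + _]; rewrite derive1E derive_val.
- by apply: derivable_within_continuous => z _; exact: ex_derive.
Qed.

Lemma atan_le u : 0 <= u -> atan u <= u.
Proof.
move=> u0; have /(_ _ _ _ u0)
  := @derive_ge0_le (fun x => x - atan x) (fun x => 1 - (1 + x ^+ 2)^-1).
rewrite atan0 subrr subr_ge0; apply.
by move=> x x0; rewrite subr_ge0 invf_le1 ?ltr_wpDr ?sqr_ge0// lerDl sqr_ge0.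
Qed.

Lemma sin_le x : 0 <= x -> sin x <= x.
Proof.
move=> x0; have /(_ _ _ _ x0) := @derive_ge0_le (fun x => x - sin x) (fun x => 1 - cos x).
rewrite sin0 subrr subr_ge0; apply.
by move=> y y0; rewrite subr_ge0 cos_le1.
Qed.

Lemma cos_ge x : 1 - x ^+ 2 / 2 <= cos x.
Proof.
rewrite -[cos x]cos_norm -[x ^+ 2]real_normK ?num_real//.
have /(_ _ _ _ (normr_ge0 x))
  := @derive_ge0_le (fun x => cos x + x ^+ 2 / 2) (fun x => - sin x + x).
rewrite cos0 expr0n /= mul0r addr0 -lerBlDr; apply.
  move=> y; apply: is_derive_eq.
  by rewrite /GRing.scale /=; field.
by move=> y y0; rewrite addrC subr_ge0 sin_le // ltW.
Qed.

Lemma atan_scale s y : 0 <= s <= 1 -> 0 <= y -> s * atan y <= atan (s * y).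
Proof.
move=> /andP[s0 s1] y0.
have /(_ _ _ _ y0) := @derive_ge0_le (fun x => atan (s * x) - s * atan x)
  (fun x => (1 + (s * x) ^+ 2)^-1 * s - s * (1 + x ^+ 2)^-1).
rewrite mulr0 atan0 mulr0 subr0 subr_ge0; apply.
  by move=> x; apply: is_deriveB; apply: is_derive_eq; rewrite /GRing.scale /= mulr1.
move=> x x0; rewrite mulrC -mulrBr mulr_ge0// subr_ge0 lef_pV2 ?posrE ?ltr_wpDr ?sqr_ge0//.
by rewrite lerD2l exprMn ler_piMl ?sqr_ge0// expr_le1.
Qed.

Lemma cos_gt0 x : - (pi / 2) < x -> x < pi / 2 -> 0 < cos x.
Proof. by move=> h1 h2; apply: cos_gt0_pihalf; rewrite h1. Qed.

Lemma tan_ge x : 0 <= x < pi / 2 -> x <= tan x.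
Proof.
move=> /andP[x0 xp].
have xI : x \in `](- (pi / 2)), (pi / 2)[.
  by rewrite in_itv /= xp andbT; apply: lt_le_trans x0; rewrite oppr_lt0 divr_gt0 ?pi_gt0.
rewrite -{1}(tanK xI) atan_le // divr_ge0 //.
  by apply: sin_ge0_pi; rewrite x0 (le_trans (ltW xp))// ler_pdivrMr// ler_peMr ?pi_ge0// ler1n.
by move: xI; rewrite in_itv /= => /andP[h1 h2]; apply/ltW/cos_gt0.
Qed.

Lemma ratio_le_expR u q : -1 < u -> 1 + u <= expR q -> u <= (1 + u) * q.
Proof.
move=> u1 uq; have := expR_ge1Dx (- q); rewrite expRN.
have u0 : 0 < 1 + u by lra.
move=> /(ler_wpM2r (ltW u0)).
have : (expR q)^-1 * (1 + u) <= 1 by rewrite mulrC ler_pdivrMr ?expR_gt0// mul1r.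
nra.
Qed.

Lemma pihalf_gt0 : 0 < pi / 2 :> R.
Proof. by rewrite divr_gt0 ?pi_gt0. Qed.

Lemma sin_le_sin x y : - (pi / 2) <= x -> x <= y -> y <= pi / 2 -> sin x <= sin y.
Proof.
move=> hx xy hy; rewrite leNgt; apply/negP.
by rewrite ltr_sin ?in_itv /= ?hx ?hy ?(le_trans hx xy) ?(le_trans xy hy)// ltNge xy.
Qed.

Lemma cos_ge0 x : - (pi / 2) <= x -> x <= pi / 2 -> 0 <= cos x.
Proof. by move=> h1 h2; apply: cos_ge0_pihalf; rewrite h1. Qed.

Lemma expR_ge1D_sqr q x y : 0 <= 1 + x -> expR q ^+ 2 = (1 + x) ^+ 2 + y ^+ 2 ->
  1 + x <= expR q.
Proof.
move=> x0 e; rewrite -(@ler_pXn2r _ 2) ?nnegrE ?expR_ge0// e lerDl sqr_ge0//.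
Qed.

Lemma expR_ge1 q : 1 <= expR q -> 0 <= q.
Proof. by rewrite -expR0 ler_expR. Qed.

Lemma atan_ge0 y : 0 <= y -> 0 <= atan y.
Proof. by move=> y0; rewrite -(atan0 R); apply: le_atan. Qed.

End RealBounds.

Section Polar.
Variable R : realType.
Implicit Types (x y r s q a b phi : R) (z : R[i]).

Definition polar r a : R[i] := ((r * cos a) +i* (r * sin a))%C.

Lemma polarM r s a b : polar r a * polar s b = polar (r * s) (a + b).
Proof.
rewrite /polar; apply/eqP; rewrite eq_complex /= cosD sinD.
by apply/andP; split; apply/eqP; ring.
Qed.

Lemma polar_div r s a b : s != 0 -> polar r a / polar s b = polar (r / s) (a - b).
Proof.
move=> s0.
have h : polar (r / s) (a - b) * polar s b = polar r a by rewrite polarM divfK// subrK.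
have p0 : polar s b != 0.
  apply/eqP => -[/eqP]; rewrite mulf_eq0 (negbTE s0) /= => /eqP c0 /eqP.
  rewrite mulf_eq0 (negbTE s0) /= => /eqP s1.
  by have := cos2Dsin2 b; rewrite c0 s1 expr0n /= addr0 => /esym/eqP; rewrite oner_eq0.
by rewrite -h mulfK.
Qed.

Lemma add1_polar x y : 0 < 1 + x -> exists q : R,
  1 + (x +i* y)%C = polar (expR q) (atan (y / (1 + x))) /\
  expR q ^+ 2 = (1 + x) ^+ 2 + y ^+ 2.
Proof.
move=> x0; set u := y / (1 + x).
have yE : y = (1 + x) * u by rewrite /u mulrC divfK// gt_eqF.
have w0 : 0 < Num.sqrt (1 + u ^+ 2) by rewrite sqrtr_gt0 ltr_pwDl// sqr_ge0.
exists (ln ((1 + x) * Num.sqrt (1 + u ^+ 2))).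
rewrite lnK ?posrE ?mulr_gt0//; split; last first.
  by rewrite exprMn sqr_sqrtr ?addr_ge0// ?sqr_ge0// {1}yE; ring.
have cE := cos_atan u.
have sE : sin (atan u) = u * cos (atan u).
  rewrite -{2}[u]atanK /tan divfK// cE gt_eqF// invr_gt0//.
apply/eqP; rewrite eq_complex /= sE cE add0r {1}yE.
by apply/andP; split; apply/eqP; field; rewrite gt_eqF.
Qed.

Lemma prod_add1_polar (S : R[i] -> Prop) (K : nat -> R -> R -> Prop) :
  K 0%N 0 0 ->
  (forall z, S z -> exists q phi, 1 + z = polar (expR q) phi /\
     forall n Q Phi, K n Q Phi -> K n.+1 (q + Q) (phi + Phi)) ->
  forall zs : seq R[i], (forall z, z \in zs -> S z) ->
  exists Q Phi, \prod_(z <- zs) (1 + z) = polar (expR Q) Phi /\ K (size zs) Q Phi.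
Proof.
move=> K0 KS; elim => [|z zs IH] Szs.
  exists 0, 0; split=> //; rewrite big_nil /polar expR0 cos0 sin0 !mul1r.
  by apply/eqP; rewrite eq_complex /= !eqxx.
have [|Q [Phi [e k]]] := IH; first by move=> w wz; apply: Szs; rewrite inE wz orbT.
have [|q [phi [eq kq]]] := KS z; first by apply: Szs; rewrite inE eqxx.
exists (q + Q), (phi + Phi); split; last exact: kq.
by rewrite big_cons e eq polarM expRD.
Qed.

Lemma zero_free_conj (d : nat) z : zero_free d z^*%C -> zero_free d z.
Proof.
move=> h G /h; apply: contra => /eqP z0.
have -> : indep_poly R[i] G = map_poly (@conjc R) (indep_poly R[i] G).
  by apply/polyP => k; rewrite coef_map /= !coef_poly; case: ifP => _; rewrite ?conjc_nat ?rmorph0.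
by rewrite horner_map z0 rmorph0.
Qed.

Lemma zero_free_region (d : nat) z (S : R[i] -> Prop) :
  (forall zs : seq R[i], (size zs <= d)%N -> (forall w, w \in zs -> S w) ->
     S (z / \prod_(w <- zs) (1 + w))) ->
  (forall w, S w -> - 2^-1 < complex.Re w) -> zero_free d.+1 z.
Proof.
move=> S1 S2 G dG; apply: (invariant_region_zero_free S1); last by rewrite dG.
  move=> w /S2 hw; apply/eqP => /(congr1 (@complex.Re R)).
  by case: w hw => a b /=; lra.
move=> w w' /S2 hw /S2 hw'; apply/eqP => /(congr1 (@complex.Re R)).
by case: w hw => a b; case: w' hw' => a' b' /=; lra.
Qed.

End Polar.

Section Regions.
Variable R : realType.
Implicit Types (r a b x y q th rho eta m : R) (z : R[i]) (n : nat).

Lemma add_natmul_le n x q Q : n%:R * x <= Q -> x <= q -> n.+1%:R * x <= q + Q.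
Proof. by move=> hQ hq; rewrite -[n.+1%:R]natr1 mulrDl mul1r addrC lerD. Qed.

Lemma natmul_le_add n x q Q : Q <= n%:R * x -> q <= x -> q + Q <= n.+1%:R * x.
Proof. by move=> hQ hq; rewrite -[n.+1%:R]natr1 mulrDl mul1r addrC lerD. Qed.

Lemma sector_factor r a b rho th : 0 <= b <= a -> a <= pi / 2 ->
  0 <= rho <= r -> - b <= th <= pi / 2 -> rho * sin th <= r * sin a ->
  exists q phi, 1 + polar rho th = polar (expR q) phi /\
    [/\ 0 <= q, - (r * sin b) <= phi, phi <= r * sin a & cos a * - phi <= sin a * q].
Proof.
move=> /andP[b0 ba] api /andP[rho0 rhor] /andP[th1 th2] him.
have p0 := pihalf_gt0 R; have ppi : pi = pi / 2 + pi / 2 :> R by rewrite -splitr.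
have x0 : 0 <= rho * cos th by rewrite mulr_ge0 ?cos_ge0//; lra.
have sa0 : 0 <= sin a by apply: sin_ge0_pi; lra.
have r0 := le_trans rho0 rhor.
have rsa : 0 <= r * sin a by rewrite mulr_ge0.
have rsb : 0 <= r * sin b by rewrite mulr_ge0 ?sin_ge0_pi//; lra.
have ca0 : 0 <= cos a by apply: cos_ge0; lra.
have y_pos : 0 <= th -> 0 <= rho * sin th.
  by move=> th0; rewrite mulr_ge0 ?sin_ge0_pi//; lra.
have y_neg : th < 0 -> [/\ 0 <= - (rho * sin th), - (rho * sin th) <= r * sin b &
    cos a * - (rho * sin th) <= sin a * (rho * cos th)].
  move=> th0; rewrite -mulrN -sinN; split.
  - by rewrite mulr_ge0 ?sin_ge0_pi//; lra.
  - by apply: ler_pM => //; [apply: sin_ge0_pi; lra|apply: sin_le_sin; lra].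
  have : 0 <= rho * sin (a + th) by rewrite mulr_ge0 ?sin_ge0_pi//; lra.
  by rewrite sinD sinN; lra.
move: x0 him y_pos y_neg; rewrite /polar.
move: (rho * cos th) (rho * sin th) => x y x0 him y_pos y_neg.
have x1 : 0 < 1 + x by lra.
have [q [-> eq2]] := add1_polar y x1; exists q, (atan (y / (1 + x))); split => //.
have xq : 1 + x <= expR q := expR_ge1D_sqr (ltW x1) eq2.
have q0 : 0 <= q by apply: expR_ge1; lra.
have xq' : x <= (1 + x) * q by apply: ratio_le_expR => //; lra.
have div_le u : 0 <= u -> u / (1 + x) <= u.
  by move=> u0; rewrite ler_pdivrMr// ler_peMr// lerDl.
have [th0|th0] := leP 0 th.
  have y0 := y_pos th0; have u0 : 0 <= y / (1 + x) by rewrite divr_ge0// ltW.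
  have t0 := atan_ge0 u0; split => //.
  - by apply: le_trans t0; rewrite oppr_le0.
  - by apply: le_trans (atan_le u0) _; exact: le_trans (div_le _ y0) him.
  by apply: (@le_trans _ _ 0); rewrite ?mulr_ge0// mulrN oppr_le0 mulr_ge0.
have [w0 wb key] := y_neg th0.
have u0 : 0 <= - y / (1 + x) by rewrite divr_ge0// ltW.
have t0 := atan_ge0 u0; have t1 := atan_le u0.
have -> : atan (y / (1 + x)) = - atan (- y / (1 + x)) by rewrite mulNr atanN opprK.
split => //.
- by rewrite lerN2; apply: le_trans t1 _; exact: le_trans (div_le _ w0) wb.
- by apply: le_trans rsa; rewrite oppr_le0.
rewrite opprK; apply: le_trans (ler_wpM2l ca0 t1) _.
rewrite mulrA ler_pdivrMr//; apply: le_trans key _.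
by rewrite -mulrA ler_wpM2l// mulrC.
Qed.

(* With theta = a - Phi the argument and |R| = r exp(-Q) the modulus of a new
   ratio, [cos a * (- Phi) <= sin a * Q] gives Im R <= r sin a, which improves
   on the bound Im R <= r. *)
Lemma sector_im_le a Q Phi : 0 <= a <= pi / 2 -> a - Phi >= - (pi / 2) -> 0 <= Q ->
  cos a * - Phi <= sin a * Q -> sin (a - Phi) <= sin a * expR Q.
Proof.
move=> /andP[a0 ap] th1 Q0 h.
have p0 := pihalf_gt0 R; have ppi : pi = pi / 2 + pi / 2 :> R by rewrite -splitr.
have sa0 : 0 <= sin a by apply: sin_ge0_pi; lra.
have ca0 : 0 <= cos a by apply: cos_ge0; lra.
apply: (@le_trans _ _ (sin a * (1 + Q))); last by rewrite ler_wpM2l// expR_ge1Dx.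
rewrite mulrDr mulr1.
have [Phi0|Phi0] := leP 0 Phi.
  apply: (@le_trans _ _ (sin a)); last by rewrite lerDl mulr_ge0.
  by apply: sin_le_sin => //; lra.
rewrite sinD lerD ?ler_piMr ?cos_le1//; apply: le_trans h.
by rewrite ler_wpM2l// sin_le// oppr_ge0 ltW.
Qed.

Lemma zero_free_sector (d : nat) r a b : 0 <= r -> 0 <= b <= a -> a <= pi / 2 ->
  d%:R * (r * sin a) <= a + b -> a + d%:R * (r * sin b) <= pi / 2 ->
  zero_free d.+1 (polar r a).
Proof.
move=> r0 hab api ha hb; have /andP[b0 ba] := hab.
have p0 := pihalf_gt0 R; have ppi : pi = pi / 2 + pi / 2 :> R by rewrite -splitr.
have rsa0 : 0 <= r * sin a by rewrite mulr_ge0 ?sin_ge0_pi//; lra.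
have rsb0 : 0 <= r * sin b by rewrite mulr_ge0 ?sin_ge0_pi//; lra.
pose S z := exists rho th, [/\ z = polar rho th, 0 <= rho <= r, - b <= th <= pi / 2 &
  rho * sin th <= r * sin a].
apply: (zero_free_region (S := S)); last first.
  move=> _ [rho [th [-> /andP[h1 _] /andP[h2 h3] _]]] /=.
  apply: (@lt_le_trans _ _ 0); first by rewrite oppr_lt0 invr_gt0.
  by rewrite mulr_ge0 ?cos_ge0//; lra.
move=> zs szs Szs.
pose K n Q Phi := [/\ 0 <= Q, n%:R * - (r * sin b) <= Phi, Phi <= n%:R * (r * sin a) &
  cos a * - Phi <= sin a * Q].
have [|| Q [Phi [-> [Q0 Phi1 Phi2 Phi3]]]] := prod_add1_polar (S := S) (K := K) _ _ Szs.
- by split; rewrite ?mul0r ?oppr0 ?mulr0.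
- move=> _ [rho [th [-> hrho hth him]]].
  have [q [phi [e [q0 f1 f2 f3]]]] := sector_factor hab api hrho hth him.
  exists q, phi; split => // n Q Phi [h1 h2 h3 h4]; split.
  + exact: addr_ge0.
  + exact: add_natmul_le.
  + exact: natmul_le_add.
  + by rewrite opprD !mulrDr lerD.
have kd : (size zs)%:R <= d%:R :> R by rewrite ler_nat.
have e0 := expR_gt0 Q.
have P1 : Phi <= a + b.
  by apply: le_trans Phi2 _; apply: le_trans ha; rewrite ler_wpM2r.
have P2 : - Phi <= d%:R * (r * sin b).
  by rewrite lerNl; apply: le_trans Phi1; rewrite mulrN lerN2 ler_wpM2r.
exists (r / expR Q), (a - Phi); split.
- by rewrite polar_div// gt_eqF.
- rewrite divr_ge0 ?(ltW e0)//= ler_pdivrMr// ler_peMr//.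
  by apply: le_trans (expR_ge1Dx Q); rewrite lerDl.
- by apply/andP; split; lra.
rewrite mulrAC ler_pdivrMr// -mulrA ler_wpM2l//.
by apply: sector_im_le => //; lra.
Qed.

Lemma cubic_factor b rho th : 0 <= b <= pi / 2 -> 0 <= rho <= 1 -> - b <= th <= pi / 2 ->
  exists q phi, 1 + polar rho th = polar (expR q) phi /\
    [/\ 0 <= q, - (b / 2) <= phi & phi <= pi / 4].
Proof.
move=> /andP[b0 b1] /andP[rho0 rho1] /andP[th1 th2].
have p0 := pihalf_gt0 R; have ppi : pi = pi / 2 + pi / 2 :> R by rewrite -splitr.
have x0 : 0 <= rho * cos th by rewrite mulr_ge0 ?cos_ge0//; lra.
have x1 : 0 < 1 + rho * cos th by lra.
have [q [e eq2]] := add1_polar (rho * sin th) x1.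
exists q, (atan (rho * sin th / (1 + rho * cos th))); split => //.
have q0 : 0 <= q.
  by apply: expR_ge1; apply: le_trans (expR_ge1D_sqr (ltW x1) eq2); rewrite lerDl.
have y1 : rho * sin th <= 1.
  apply: (le_trans (ler_norm _)); rewrite normrM ger0_norm//.
  by rewrite mulr_ile1// sin_max.
split => //; last first.
  rewrite -atan1; apply: le_atan; rewrite ler_pdivrMr// mul1r.
  by apply: le_trans y1 _; rewrite lerDl.
have [th0|th0] := leP 0 th.
  apply: (@le_trans _ _ 0); first by rewrite oppr_le0 divr_ge0.
  apply: atan_ge0; apply: divr_ge0 (ltW x1).
  by rewrite mulr_ge0 ?sin_ge0_pi//; lra.
have thE : th = - ((- th / 2) *+ 2) by rewrite -mulr_natr divfK// opprK.
have hb : - th / 2 <= b / 2 by lra.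
have h0 : 0 <= - th / 2 by lra.
have h1 : - th / 2 < pi / 2 by lra.
move: (- th / 2) thE hb h0 h1 => h thE hb h0 h1.
have c0 : 0 < cos h by apply: cos_gt0; lra.
have s0 : 0 <= sin h by apply: sin_ge0_pi; lra.
apply: (@le_trans _ _ (- h)); first by rewrite lerN2.
rewrite -[X in - X](@tanK _ h); last by rewrite in_itv/= h1 andbT; lra.
rewrite -atanN; apply: le_atan.
rewrite /tan -mulNr ler_pdivrMr// mulrAC ler_pdivlMr//.
rewrite thE sinN cosN sin_mulr2n cos_mulr2n !mulr2n.
have -> : - sin h * (1 + rho * (cos h ^+ 2 + cos h ^+ 2 - 1)) =
   - sin h * (1 - rho) + rho * - (cos h * sin h + cos h * sin h) * cos h by ring.
by rewrite gerDr mulNr oppr_le0 mulr_ge0// subr_ge0.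
Qed.

Lemma zero_free_cubic r a : 0 <= r <= 1 -> 0 <= a <= pi / 2 -> zero_free 3 (polar r a).
Proof.
move=> /andP[r0 r1] /andP[a0 api]; have p0 := pihalf_gt0 R.
pose b := pi / 2 - a; have b0 : 0 <= b by rewrite subr_ge0.
have b1 : b <= pi / 2 by rewrite gerBl.
pose S z := exists rho th, [/\ z = polar rho th, 0 <= rho <= 1 & - b <= th <= pi / 2].
apply: (zero_free_region (S := S)); last first.
  move=> _ [rho [th [-> /andP[h1 _] /andP[h2 h3]]]] /=.
  apply: (@lt_le_trans _ _ 0); first by rewrite oppr_lt0 invr_gt0.
  rewrite mulr_ge0 ?cos_ge0//; apply: le_trans h2; by rewrite lerN2.
move=> zs szs Szs.
pose K n (Q Phi : R) :=
  [/\ 0 <= Q, n%:R * - (b / 2) <= Phi & Phi <= n%:R * (pi / 4)].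
have [|| Q [Phi [-> [Q0 Phi1 Phi2]]]] := prod_add1_polar (S := S) (K := K) _ _ Szs.
- by split; rewrite ?mul0r.
- move=> _ [rho [th [-> hrho hth]]].
  have [|q [phi [e [q0 f1 f2]]]] := @cubic_factor b rho th _ hrho hth; first by rewrite b0.
  exists q, phi; split => // n Q Phi [h1 h2 h3]; split.
  + exact: addr_ge0.
  + exact: add_natmul_le.
  + exact: natmul_le_add.
have kd : (size zs)%:R <= 2 :> R by rewrite ler_nat.
have e0 := expR_gt0 Q.
have P1 : Phi <= pi / 2.
  apply: le_trans Phi2 _; apply: (@le_trans _ _ (2 * (pi / 4))); last lra.
  by rewrite ler_wpM2r// divr_ge0// pi_ge0.
have P2 : - Phi <= b.
  rewrite lerNl; apply: le_trans Phi1; rewrite mulrN lerN2.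
  by rewrite mulrA ler_pdivrMr// mulrC ler_wpM2l.
exists (r / expR Q), (a - Phi); split.
- by rewrite polar_div// gt_eqF.
- rewrite divr_ge0 ?(ltW e0)//= ler_pdivrMr// mul1r; apply: le_trans r1 _.
  by apply: le_trans (expR_ge1Dx Q); rewrite lerDl.
by rewrite /b in P2 *; apply/andP; split; lra.
Qed.

Lemma near_imaginary_point r eta rho th : 0 < rho -> r <= 1 -> 0 <= eta ->
  rho * expR eta <= r -> - eta <= th <= pi / 2 + eta ->
  [/\ rho <= r, - (rho * eta) <= rho * cos th & rho * sin th <= r * (1 + rho * cos th)].
Proof.
move=> rho0 r1 eta0 h2 /andP[h3 h4]; have p0 := pihalf_gt0 R.
have p1 := pihalf_ge1 R.
have eE : rho * (1 + eta) <= r.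
  by apply: le_trans h2; rewrite ler_wpM2l ?(ltW rho0)// expR_ge1Dx.
have re0 : 0 <= rho * eta by rewrite mulr_ge0// ltW.
have rr : rho <= r by move: eE; rewrite mulrDr mulr1; apply: le_trans; rewrite lerDl.
have r0 : 0 <= r by apply: le_trans rr; exact: ltW.
have ce' : eta <= 1 -> - (rho * eta) <= rho * cos th.
  move=> eta1; rewrite -mulrN ler_wpM2l ?(ltW rho0)//.
  have [tp|tp] := leP th (pi / 2).
    apply: (@le_trans _ _ 0); first by rewrite oppr_le0.
    by apply: cos_ge0 => //; lra.
  have -> : cos th = - sin (th - pi / 2) by rewrite sinBpihalf opprK.
  rewrite lerN2; apply: (@le_trans _ _ (th - pi / 2)); last by lra.
  by rewrite sin_le// subr_ge0 ltW.
have ce : - (rho * eta) <= rho * cos th.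
  have [|eta1] := leP eta 1; first exact: ce'.
  by rewrite -mulrN ler_wpM2l ?(ltW rho0)//; apply: le_trans (cos_geN1 th); rewrite lerN2 ltW.
split => //; apply: (@le_trans _ _ rho); first by rewrite ler_piMr ?(ltW rho0)// sin_le1.
apply: (@le_trans _ _ (r * (1 - rho * eta))); last by rewrite ler_wpM2l// lerD2l.
have : r * (rho * eta) <= rho * eta by rewrite ler_piMl.
by move: eE; rewrite !mulrDr !mulr1 mulrN; lra.
Qed.

Lemma near_imaginary_factor r m eta rho th : r <= 1 -> 0 < m -> 0 <= eta ->
  eta <= m ^+ 2 / 8 -> m <= rho <= r -> - eta <= th <= pi / 2 + eta ->
  - (rho * eta) <= rho * cos th -> rho * sin th <= r * (1 + rho * cos th) ->
  exists q phi, 1 + polar rho th = polar (expR q) phi /\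
    [/\ eta <= q, q <= r, - (r * eta) <= phi & phi <= atan r].
Proof.
move=> r1 m0 eta0 etam /andP[rm rr] /andP[t1 t2] hx hy.
have p1 := pihalf_ge1 R; have ppi : pi = pi / 2 + pi / 2 :> R by rewrite -splitr.
have rho0 : 0 < rho := lt_le_trans m0 rm.
have r0 : 0 <= r by apply: le_trans rr; exact: ltW.
have m1 : m <= 1 by apply: le_trans r1; exact: le_trans rr.
have m2 : m ^+ 2 <= m by rewrite expr2 ler_piMr// ltW.
have xe : rho * eta <= 8^-1.
  rewrite -[8^-1]mul1r; apply: ler_pM; rewrite ?(ltW rho0)//; first exact: le_trans r1.
  by lra.
have sq : (rho * cos th) ^+ 2 + (rho * sin th) ^+ 2 = rho ^+ 2.
  by rewrite !exprMn -mulrDr cos2Dsin2 mulr1.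
have hc : rho * cos th <= rho by rewrite ler_piMr ?cos_le1// ltW.
have hs : th < 0 -> - (rho * eta) <= rho * sin th /\ 0 <= rho * cos th.
  move=> t0; split; last by rewrite mulr_ge0 ?cos_ge0 ?(ltW rho0)//; lra.
  rewrite -mulrN ler_wpM2l ?(ltW rho0)// -[sin th]opprK -sinN lerN2.
  by apply: (@le_trans _ _ (- th)); rewrite ?sin_le ?oppr_ge0 ?(ltW t0)// lerNl.
have hs' : 0 <= th -> 0 <= rho * sin th.
  by move=> t0; rewrite mulr_ge0 ?sin_ge0_pi ?(ltW rho0)//; lra.
move: hs hs' sq hc hx hy; rewrite /polar.
move: (rho * cos th) (rho * sin th) => x y hs hs' sq hc hx hy.
have x1 : 0 < 1 + x by lra.
have [q [-> eq2]] := add1_polar y x1; exists q, (atan (y / (1 + x))); split => //.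
have q2 : expR (q + q) = 1 + 2 * x + rho ^+ 2.
  by rewrite expRD -expr2 eq2 -sq; ring.
have q_lo : eta <= q.
  have v1 : 1 + 3 / 4 * m ^+ 2 <= expR (q + q).
    rewrite q2 -addrA lerD2l.
    have h1 : rho * eta <= rho * (m / 8) by rewrite ler_wpM2l ?(ltW rho0)//; lra.
    have h2 : m ^+ 2 <= rho * m by rewrite expr2 ler_wpM2r// ltW.
    have h3 : rho * m <= rho ^+ 2 by rewrite expr2 ler_wpM2l// ltW.
    by move: hx h1 h2 h3; clear; lra.
  have m3 : 0 <= m ^+ 2 by rewrite sqr_ge0.
  have q0 : 0 <= q + q by apply: expR_ge1; move: v1 m3; clear; lra.
  have q3 : 3 / 4 * m ^+ 2 * (q + q) <= 1 * (q + q).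
    by rewrite ler_wpM2r//; move: m1 m2; clear; lra.
  have := @ratio_le_expR _ (3 / 4 * m ^+ 2) (q + q).
  have m4 : -1 < 3 / 4 * m ^+ 2 by move: m3; clear; lra.
  by move=> /(_ m4 v1); move: m3 q3 etam; clear; lra.
have q_hi : q <= r.
  apply: le_trans rr; rewrite -ler_expR; apply: le_trans (expR_ge1Dx rho).
  rewrite -(@ler_pXn2r _ 2) ?nnegrE ?expR_ge0 ?addr_ge0 ?(ltW rho0)//.
  by rewrite expr2 -expRD q2; move: hc; clear; lra.
have re0 : 0 <= r * eta by rewrite mulr_ge0.
split => //; last by apply: le_atan; rewrite ler_pdivrMr.
have [th0|/hs[y0 x0]] := leP 0 th.
  apply: (@le_trans _ _ 0); first by rewrite oppr_le0.
  by apply: atan_ge0; apply: divr_ge0 (ltW x1); exact: hs'.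
have re : rho * eta <= r * eta by rewrite ler_wpM2r.
apply: (@le_trans _ _ (atan (- (r * eta)))); first by rewrite atanN lerN2 atan_le.
apply: le_atan; rewrite ler_pdivlMr// mulrDr mulr1.
have : 0 <= r * eta * x by rewrite mulr_ge0.
by move: y0 re; clear; lra.
Qed.

(* At r i the leaves have ratio r i, and every other ratio is bounded away both
   from 0 and from the circle of radius r, which absorbs a perturbation eta of
   the argument. *)
Lemma zero_free_near_imaginary (d : nat) r m eta :
  r <= 1 -> d%:R * r <= 2 -> d%:R * atan r <= pi / 2 ->
  0 < m -> m <= r * expR (- (d%:R * r)) -> 0 <= eta -> eta <= m ^+ 2 / 8 ->
  zero_free d.+1 (polar r (pi / 2 - eta)).
Proof.
move=> r1 dr2 dar m0 mr eta0 etam; have p0 := pihalf_gt0 R.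
have p1 := pihalf_ge1 R.
have r0 : 0 < r by move: (lt_le_trans m0 mr); rewrite pmulr_lgt0// expR_gt0.
have d0 : 0 <= d%:R :> R by rewrite ler0n.
have re0 : 0 <= r * eta by rewrite mulr_ge0// ltW.
have mr' : m <= r.
  apply: le_trans mr _; rewrite ler_piMr ?(ltW r0)//.
  by rewrite expR_le1 oppr_le0 mulr_ge0// ltW.
have eta1 : eta <= 8^-1.
  apply: le_trans etam _; rewrite ler_piMl//.
  by rewrite expr_le1 ?(ltW m0)//; exact: le_trans r1.
pose S z := z = polar r (pi / 2 - eta) \/
  exists rho th, [/\ z = polar rho th, m <= rho, rho * expR eta <= r &
  - eta <= th <= pi / 2 + eta].
have SP z : S z -> exists rho th, [/\ z = polar rho th, m <= rho <= r,
    - eta <= th <= pi / 2 + eta, - (rho * eta) <= rho * cos th &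
    rho * sin th <= r * (1 + rho * cos th)].
  case=> [->|[rho [th [-> h1 h2 h3]]]].
    exists r, (pi / 2 - eta); rewrite mr' lexx.
    have rc0 : 0 <= r * cos (pi / 2 - eta).
      by rewrite mulr_ge0 ?(ltW r0)//; apply: cos_ge0; lra.
    split => //; first by apply/andP; split; lra.
      by apply: le_trans rc0; rewrite oppr_le0.
    rewrite ler_wpM2l ?(ltW r0)//; apply: le_trans (sin_le1 _) _.
    by rewrite lerDl.
  exists rho, th; have rho0 : 0 < rho := lt_le_trans m0 h1.
  have [h4 h5 h6] := near_imaginary_point rho0 r1 eta0 h2 h3.
  by split => //; rewrite h1.
apply: (zero_free_region (S := S)); last first.
  move=> _ /SP[rho [th [-> /andP[h1 h2] h3 h4 _]]] /=.
  have : rho * eta <= 1 * 8^-1.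
    by apply: ler_pM => //; [exact: le_trans (ltW m0) _|exact: le_trans r1].
  by move: h4; clear; lra.
move=> zs szs Szs.
pose K n (Q Phi : R) :=
  [/\ n%:R * eta <= Q, Q <= n%:R * r, n%:R * - (r * eta) <= Phi & Phi <= n%:R * atan r].
have [|| Q [Phi [-> [Q0 Q1 Phi1 Phi2]]]] := prod_add1_polar (S := S) (K := K) _ _ Szs.
- by split; rewrite ?mul0r.
- move=> _ /SP[rho [th [-> h1 h2 h3 h4]]].
  have [q [phi [e [f1 f2 f3 f4]]]] := near_imaginary_factor r1 m0 eta0 etam h1 h2 h3 h4.
  exists q, phi; split => // n Q Phi [g1 g2 g3 g4]; split.
  + exact: add_natmul_le.
  + exact: natmul_le_add.
  + exact: add_natmul_le.
  + exact: natmul_le_add.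
have kd : (size zs)%:R <= d%:R :> R by rewrite ler_nat.
have e0 := expR_gt0 Q.
rewrite polar_div ?gt_eqF//.
case: zs szs {Szs} kd Q0 Q1 Phi1 Phi2 => [|z zs] _ kd Q0 Q1 Phi1 Phi2.
  rewrite /= !mul0r in Q0 Q1 Phi1 Phi2.
  have -> : Q = 0 by apply/eqP; rewrite eq_le Q0 Q1.
  have -> : Phi = 0 by apply/eqP; rewrite eq_le Phi1 Phi2.
  by left; rewrite expR0 divr1 subr0.
right; exists (r / expR Q), (pi / 2 - eta - Phi).
have P1 : Phi <= pi / 2.
  apply: le_trans Phi2 _; apply: le_trans dar; rewrite ler_wpM2r//.
  by apply: atan_ge0; exact: ltW.
have P2 : - Phi <= 2 * eta.
  apply: (@le_trans _ _ (d%:R * (r * eta))); last by rewrite mulrA ler_wpM2r.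
  by rewrite lerNl; apply: le_trans Phi1; rewrite mulrN lerN2 ler_wpM2r.
split => //.
- apply: le_trans mr _; rewrite -expRN ler_wpM2l ?(ltW r0)// ler_expR lerN2.
  by apply: le_trans Q1 _; rewrite ler_wpM2r// ltW.
- rewrite mulrAC ler_pdivrMr// ler_wpM2l ?(ltW r0)// ler_expR.
  by apply: le_trans Q0; rewrite ler_peMl// ler1n.
- by move: P1 P2; clear => P1 P2; apply/andP; split; lra.
Qed.

End Regions.

Section Numerics.
Variable R : realType.
Implicit Types (x y r s q a b : R).

Lemma sin_pi6 : sin (pi / 6) = 1 / 2 :> R.
Proof.
have p0 := pi_gt0 R.
have s0 : 0 < sin (pi / 6) :> R by apply: sin_gt0_pi; apply/andP; split; lra.
have e : cos ((pi / 6) *+ 2) = sin (pi / 6) :> R.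
  have -> : (pi / 6) *+ 2 = - (pi / 6 - pi / 2) :> R by rewrite mulr2n; lra.
  by rewrite cosN cosBpihalf.
move: e; rewrite cos_mulr2n cos2sin2 mulr2n => e.
have : (2 * sin (pi / 6) - 1) * (sin (pi / 6) + 1) = 0 :> R by lra.
by move/eqP; rewrite mulf_eq0 => /orP[] /eqP; lra.
Qed.

Lemma cos_pi6_sqr : cos (pi / 6) ^+ 2 = 3 / 4 :> R.
Proof. by rewrite cos2sin2 sin_pi6; lra. Qed.

Lemma pi_ge_25_8 : 25 / 8 <= pi :> R.
Proof.
have c0 : 0 <= cos (pi / 6) :> R.
  by have p0 := pi_gt0 R; apply: cos_ge0; lra.
have c6 : cos (pi / 6) <= 97 / 112 :> R.
  have := cos_pi6_sqr; rewrite expr2; nra.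
have e : cos ((pi / 12) *+ 2) = cos (pi / 6) :> R by congr cos; rewrite mulr2n; lra.
have c12 : cos (pi / 12) <= 142 / 147 :> R.
  by move: e; rewrite cos_mulr2n expr2 mulr2n; nra.
have := cos_ge (pi / 12 : R); have := pi_gt0 R.
rewrite expr2; nra.
Qed.

Lemma tan_pi6 : 0 <= tan (pi / 6) :> R /\ tan (pi / 6) ^+ 2 = 1 / 3 :> R.
Proof.
have c0 : 0 <= cos (pi / 6) :> R.
  by have p0 := pi_gt0 R; apply: cos_ge0; lra.
split; first by rewrite divr_ge0// sin_pi6; lra.
by rewrite /tan exprMn exprVn cos_pi6_sqr sin_pi6; lra.
Qed.

Lemma cos_double_le y : 0 <= y < pi / 2 -> cos (y *+ 2) * (1 + y ^+ 2) <= 1 - y ^+ 2.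
Proof.
move=> hy; have := tan_ge hy; move: hy => /andP[y0 yp] ty.
have c0 : 0 < cos y by apply: cos_gt0; lra.
have sy : y * cos y <= sin y by move: ty; rewrite /tan ler_pdivlMr.
have h : (y * cos y) ^+ 2 <= sin y ^+ 2.
  by rewrite ler_pXn2r ?nnegrE//; [rewrite mulr_ge0// ltW|
    apply: le_trans sy; rewrite mulr_ge0// ltW].
have := cos2Dsin2 y; rewrite cos_mulr2n mulr2n; rewrite exprMn in h.
lra.
Qed.

Lemma sector_bound_small a : 0 <= a <= pi / 2 ->
  a + 47 / 31 * (47 / 31 * sin a - a) <= pi / 2.
Proof.
move=> /andP[a0 ap]; pose y := (pi / 2 - a) / 2.
have p1 := pi_ge_25_8; have p2 := pihalf_lt2 R.
have y0 : 0 <= y by rewrite /y; lra.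
have y1 : y <= 1 by rewrite /y; lra.
have aE : a = pi / 2 - y *+ 2 by rewrite -[y *+ 2]mulr_natr /y; lra.
have sE : sin a = cos (y *+ 2) by rewrite aE -cosBpihalf -cosN; congr cos; lra.
have := @cos_double_le y; rewrite -sE => h0.
have h : sin a * (1 + y ^+ 2) <= 1 - y ^+ 2 by apply: h0; apply/andP; split; lra.
move: {sE h0} (sin a) h => S h.
have -> : a = pi / 2 - 2 * y by rewrite aE -[y *+ 2]mulr_natr; lra.
have y2 : 0 < 1 + y ^+ 2 by rewrite ltr_pwDl// sqr_ge0.
rewrite -subr_ge0 -(pmulr_lge0 _ y2) {y2}; move: h y0 y1 p1; rewrite !expr2.
move: (pi : R) => p h y0 y1 p1.
have yy : 0 <= y * y by rewrite mulr_ge0.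
have py : 0 <= (p - 25 / 8) * (y * y) by rewrite mulr_ge0//; lra.
have [y3|y3] := leP y (3 / 10).
  have : 0 <= (3 / 10 - y) * (y * y) by rewrite mulr_ge0//; lra.
  have : 0 <= (y - 2 / 17) * (y - 2 / 17) by rewrite -expr2 sqr_ge0.
  by lra.
have : 0 <= (1 - y) * (y * y) by rewrite mulr_ge0//; lra.
have : 0 <= (y - 3 / 10) * y by rewrite mulr_ge0//; lra.
lra.
Qed.

End Numerics.

Section Domain.
Variable R : realType.
Implicit Types (x y r s q a b t : R) (z w : R[i]).

Definition cnorm z : R := complex.Re `|z|.

Lemma cnormE z : cnorm z = Num.sqrt (complex.Re z ^+ 2 + complex.Im z ^+ 2).
Proof. by rewrite /cnorm normc_def. Qed.

Lemma normCE z : `|z| = (cnorm z)%:C%C.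
Proof. by rewrite cnormE normc_def. Qed.

Lemma cnorm_ge0 z : 0 <= cnorm z.
Proof. by rewrite cnormE sqrtr_ge0. Qed.

Lemma cnorm_sqr z : cnorm z ^+ 2 = complex.Re z ^+ 2 + complex.Im z ^+ 2.
Proof. by rewrite cnormE sqr_sqrtr// addr_ge0// sqr_ge0. Qed.

Lemma cnorm_conj z : cnorm z^*%C = cnorm z.
Proof. by case: z => x y; rewrite !cnormE /= sqrrN. Qed.

Lemma cnormM x z : cnorm (x%:C%C * z) = `|x| * cnorm z.
Proof.
by rewrite /cnorm normrM !normCE /= !mul0r subr0 cnormE /= expr0n addr0 sqrtr_sqr.
Qed.

Lemma cnorm_triangle z w : cnorm (z + w) <= cnorm z + cnorm w.
Proof. by have := ler_normD z w; rewrite !normCE -rmorphD /= lecR. Qed.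

Lemma Re_le_cnorm z : `|complex.Re z| <= cnorm z.
Proof. by have := normc_ge_Re z; rewrite normCE lecR. Qed.

Lemma Im_le_cnorm z : `|complex.Im z| <= cnorm z.
Proof.
rewrite -(@ler_pXn2r _ 2) ?nnegrE ?cnorm_ge0// cnorm_sqr real_normK ?num_real//.
by rewrite lerDr sqr_ge0.
Qed.

Lemma half_diskE r z : half_disk r z <-> 0 <= complex.Re z /\ cnorm z <= r.
Proof. by rewrite /half_disk /= normCE lecR. Qed.

Lemma polar_repr z : 0 <= complex.Re z -> 0 <= complex.Im z ->
  exists2 a, 0 <= a <= pi / 2 & z = polar (cnorm z) a.
Proof.
case: z => x y /= x0 y0; have sq := cnorm_sqr (x +i* y)%C; rewrite /= in sq.
have [n0|n0] := eqVneq (cnorm (x +i* y)%C) 0.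
  exists 0; first by rewrite lexx ltW// pihalf_gt0.
  have x2 := sqr_ge0 x; have y2 := sqr_ge0 y.
  move: sq; rewrite n0 expr0n /= => sq.
  have /eqP : x ^+ 2 = 0 by lra.
  have /eqP : y ^+ 2 = 0 by lra.
  by rewrite !sqrf_eq0 => /eqP-> /eqP->; rewrite /polar !mul0r.
set n := cnorm _ in n0 sq *.
have np : 0 < n by rewrite lt_neqAle eq_sym n0 cnorm_ge0.
have xn : x <= n by have := Re_le_cnorm (x +i* y)%C; rewrite /= ger0_norm.
have u0 : 0 <= x / n by rewrite divr_ge0// ltW.
have u1 : x / n <= 1 by rewrite ler_pdivrMr// mul1r.
have uI : -1 <= x / n <= 1 by rewrite u1 andbT; lra.
have c := @acosK R (x / n); rewrite in_itv /= uI in c.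
exists (acos (x / n)).
  rewrite acos_ge0//= leNgt; apply/negP => h.
  have := @cosDpihalf R (acos (x / n) - pi / 2); rewrite subrK c// => e.
  have : 0 < sin (acos (x / n) - pi / 2).
    apply: sin_gt0_pi; have := acos_lepi uI; have := pi_gt0 R => p0 p1.
    by apply/andP; split; lra.
  by lra.
rewrite /polar c// sin_acos// [n * (x / n)]mulrC divfK//.
have -> : 1 - (x / n) ^+ 2 = (y / n) ^+ 2.
  by rewrite !expr_div_n sq; field; rewrite -sq expf_neq0.
by rewrite sqrtr_sqr ger0_norm ?divr_ge0 ?(ltW np)// [n * _]mulrC divfK.
Qed.

Lemma carg_cos z : z != 0 -> 0 <= `|carg z| <= pi /\ cos (carg z) = complex.Re z / cnorm z.
Proof.
move=> z0; rewrite /carg (negbTE z0) -/(cnorm z) /=.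
have n0 : 0 < cnorm z.
  rewrite lt_neqAle cnorm_ge0 andbT eq_sym; apply: contraNneq z0 => e.
  by rewrite -normr_eq0 normCE e.
have uI : -1 <= complex.Re z / cnorm z <= 1.
  by rewrite -ler_norml normrM normfV (ger0_norm (cnorm_ge0 z)) ler_pdivrMr// mul1r Re_le_cnorm.
have c := @acosK R (complex.Re z / cnorm z); rewrite in_itv /= uI in c.
by case: ifP => _; rewrite ?normrN ?cosN ger0_norm ?acos_ge0 ?acos_lepi// c.
Qed.

Lemma atan_tan_div (d : nat) : (2 <= d)%N ->
  let t : R := tan (pi / (2 * d%:R)) in atan t = pi / (2 * d%:R) /\ 0 < t <= 1.
Proof.
move=> d2 t; have p0 := pi_gt0 R.
have dr : 2 <= d%:R :> R by rewrite (ler_nat R 2 d).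
have d0 : 0 < 2 * d%:R :> R by lra.
have x0 : 0 < (pi : R) / (2 * d%:R) by rewrite divr_gt0.
have x1 : (pi : R) / (2 * d%:R) <= pi / 4.
  by rewrite ler_pM2l// lef_pV2 ?posrE//; lra.
have at_ : atan t = pi / (2 * d%:R) by rewrite tanK// in_itv /=; apply/andP; split; lra.
split => //; apply/andP; split.
  by rewrite ltNge; apply/negP => /le_atan; rewrite at_ atan0; lra.
by rewrite leNgt; apply/negP => /lt_atan; rewrite at_ atan1; lra.
Qed.

Lemma mul_tan_div_le (d : nat) : (3 <= d)%N -> d%:R * tan (pi / (2 * d%:R)) <= 97 / 56 :> R.
Proof.
move=> d3; have [at_ /andP[t0 t1]] := @atan_tan_div d (ltnW d3).
have [y0 y2] := tan_pi6 R.
have dr : 3 <= d%:R :> R by rewrite (ler_nat R 3 d).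
have d0 : d%:R != 0 :> R by rewrite gt_eqF//; lra.
have s1 : 0 <= (3 : R) / d%:R <= 1.
  by rewrite divr_ge0 ?ler0n//= ler_pdivrMr ?mul1r//; lra.
have := atan_scale s1 y0; rewrite tanK; last first.
  by rewrite in_itv /=; have p0 := pi_gt0 R; apply/andP; split; lra.
have -> : 3 / d%:R * (pi / 6) = pi / (2 * d%:R) :> R by field.
move=> h; rewrite -at_ in h.
have {}h : tan (pi / (2 * d%:R)) <= 3 / d%:R * tan (pi / 6 : R).
  by rewrite leNgt; apply/negP => /lt_atan; rewrite ltNge h.
apply: (@le_trans _ _ (3 * tan (pi / 6))).
  have -> : 3 * tan (pi / 6) = d%:R * (3 / d%:R * tan (pi / 6)) :> R
    by rewrite mulrA [_ * (3 / _)]mulrC divfK.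
  by rewrite ler_wpM2l ?ler0n.
move: (tan (pi / 6)) y0 y2 => y y0; rewrite expr2 => y2; nra.
Qed.

End Domain.

Section ZeroFree.
Variable R : realType.
Implicit Types (x y r s q a b t : R) (z w : R[i]).

(* [3 / (2 d)] is a lower bound of |l| for the points of [near_domain] that are
   only covered by the third cone. *)
Definition delta (d : nat) : R := (3 / (2 * d%:R) * expR (- 2)) ^+ 2 / 8.

(* [47 / 31] is slightly above 7 sqrt 3 / 8, and sqrt 3 is the maximum of
   d tan (pi / 2d) over d >= 3. *)
Definition near_domain (d : nat) : set R[i] :=
  [set z | [\/ d%:R * cnorm z < 47 / 31, `|complex.Im z| < complex.Re z / 2 |
             complex.Re z < delta d * `|complex.Im z|]].

Lemma zero_free_small (d : nat) r a : 0 <= r -> 0 <= a <= pi / 2 ->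
  d%:R * r <= 47 / 31 -> zero_free d.+1 (polar r a).
Proof.
move=> r0 ha small; have /andP[a0 ap] := ha.
have p0 := pihalf_gt0 R; have ppi : pi = pi / 2 + pi / 2 :> R by rewrite -splitr.
have sa0 : 0 <= sin a by apply: sin_ge0_pi; lra.
have sa1 := sin_le a0.
have drs x y : 0 <= x -> x <= y -> d%:R * (r * x) <= 47 / 31 * y.
  by move=> x0 xy; rewrite mulrA ler_pM// mulr_ge0.
have [neg|pos] := leP (47 / 31 * sin a) a.
  apply: (@zero_free_sector _ _ _ _ 0) => //; rewrite ?lexx ?addr0 ?sin0 ?mulr0 ?addr0//.
  by apply: le_trans neg; exact: drs.
have := sector_bound_small ha.
have bE : a + (47 / 31 * sin a - a) = 47 / 31 * sin a by rewrite addrC subrK.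
have b0 : 0 <= 47 / 31 * sin a - a by rewrite subr_ge0 ltW.
have b1 : 47 / 31 * sin a - a <= a by move: sa1 a0; clear; lra.
move: (47 / 31 * sin a - a) bE b0 b1 => b bE b0 b1 hb.
apply: (@zero_free_sector _ _ _ _ b) => //; first by rewrite b0.
  by rewrite bE; exact: drs.
apply: le_trans hb; rewrite lerD2l drs//; last exact: sin_le.
by apply: sin_ge0_pi; rewrite b0; lra.
Qed.

Lemma zero_free_cone (d : nat) r a : 0 <= r -> 0 <= a <= pi / 2 ->
  d%:R * r <= 2 -> sin a < cos a / 2 -> zero_free d.+1 (polar r a).
Proof.
move=> r0 /andP[a0 ap] dr2 h.
have p1 := pi_ge_25_8 R; have sa1 := sin_le a0.
have sa0 : 0 <= sin a by apply: sin_ge0_pi; lra.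
have c0 : 0 < cos a by lra.
have a2 : a < pi / 2.
  by rewrite lt_neqAle ap andbT; apply: contraTneq c0 => ->; rewrite cos_pihalf ltxx.
have a1 : a <= 1 / 2.
  apply: (@le_trans _ _ (tan a)); first by apply: tan_ge; rewrite a0.
  by rewrite /tan ler_pdivrMr// mul1r mulrC ltW.
have drs : d%:R * (r * sin a) <= 2 * a by rewrite mulrA ler_pM// mulr_ge0.
apply: (@zero_free_sector _ _ _ _ a) => //; first by rewrite a0 lexx.
  by move: drs; clear; lra.
by move: drs a1 p1; clear; lra.
Qed.

Lemma zero_free_quarter (d : nat) r a : (3 <= d)%N ->
  0 <= r <= tan (pi / (2 * d%:R)) -> 0 <= a <= pi / 2 ->
  [\/ d%:R * r < 47 / 31, sin a < cos a / 2 | cos a < delta d * sin a] ->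
  zero_free d.+1 (polar r a).
Proof.
move=> d3 /andP[r0 rt] ha hyp; have /andP[a0 ap] := ha.
have [at_ /andP[t0 t1]] := @atan_tan_div R d (ltnW d3).
have dt := @mul_tan_div_le R d d3.
have d0 : 0 < d%:R :> R by rewrite ltr0n (leq_trans _ d3).
set t : R := tan _ in rt at_ t0 t1 dt.
have dr2 : d%:R * r <= 2.
  by apply: (le_trans (ler_wpM2l (ltW d0) rt)); move: dt; clear; lra.
have [small|large] := leP (d%:R * r) (47 / 31); first exact: zero_free_small.
case: hyp => [/ltW h|h|h]; [exact: zero_free_small|exact: zero_free_cone|].
have p0 := pihalf_gt0 R; have ppi : pi = pi / 2 + pi / 2 :> R by rewrite -splitr.
have s0 : 0 < sin a.
  rewrite lt_neqAle sin_ge0_pi ?andbT 1?eq_sym; last by rewrite a0; lra.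
  apply: contraTneq h => ->; rewrite mulr0 -leNgt.
  by apply: cos_ge0 => //; lra.
have a1 : 0 < a.
  by rewrite lt_neqAle a0 andbT eq_sym; apply: contraTneq s0 => ->; rewrite sin0 ltxx.
have eta_tan : pi / 2 - a <= cos a / sin a.
  have -> : cos a / sin a = tan (pi / 2 - a).
    by rewrite /tan -opprB sinN sinBpihalf opprK cosN cosBpihalf.
  by apply: tan_ge; rewrite subr_ge0 ap gtrBl.
have aE : a = pi / 2 - (pi / 2 - a) by rewrite opprB addrC subrK.
rewrite aE; apply: (@zero_free_near_imaginary _ _ _ (3 / (2 * d%:R) * expR (- 2))) => //.
- exact: le_trans t1.
- apply: (@le_trans _ _ (d%:R * atan t)).
    by rewrite ler_wpM2l ?(ltW d0)//; exact: le_atan.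
  by rewrite at_ le_eqVlt; apply/orP; left; apply/eqP; field; rewrite gt_eqF.
- by rewrite mulr_gt0 ?expR_gt0// divr_gt0// mulr_gt0.
- have rd : 3 / (2 * d%:R) <= r.
    by rewrite ler_pdivrMr ?mulr_gt0//; move: large; clear; lra.
  have ed : expR (- 2) <= expR (- (d%:R * r)) by rewrite ler_expR lerN2.
  by apply: ler_pM => //; rewrite ?expR_ge0// divr_ge0// mulr_ge0// ltW.
- by rewrite subr_ge0.
by apply: (le_trans eta_tan); rewrite ler_pdivrMr// ltW.
Qed.

Lemma zero_free_near_domain (d : nat) z : (3 <= d)%N ->
  half_disk (tan (pi / (2 * d%:R))) z -> near_domain d z -> zero_free d.+1 z.
Proof.
move=> d3.
wlog im0 : z / 0 <= complex.Im z.
  move=> H hz nz; have [im0|im0] := leP 0 (complex.Im z); first exact: H.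
  apply: zero_free_conj; apply: H.
  - by case: z im0 {hz nz} => x y /=; lra.
  - by move: hz; rewrite !half_diskE cnorm_conj; case: z {im0 nz}.
  - by move: nz; rewrite /near_domain /= cnorm_conj; case: z {im0 hz} => x y /=; rewrite normrN.
move=> /half_diskE[re0 zt] nz.
have [a ha e] := polar_repr re0 im0.
rewrite e; apply: zero_free_quarter => //; first by rewrite cnorm_ge0.
move: nz; rewrite /near_domain /= {2 3 4 5}e /polar /=.
have n0 := cnorm_ge0 z; move: (cnorm z) n0 => n n0.
have [-> _|n1] := eqVneq n 0; first by apply: Or31; rewrite mulr0; lra.
have np : 0 < n by rewrite lt_neqAle eq_sym n1.
have s0 : 0 <= sin a.
  by apply: sin_ge0_pi; move: ha => /andP[a0 a1]; rewrite a0/=; have := pihalf_gt0 R; lra.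
rewrite normrM !ger0_norm//.
case=> h; [exact: Or31|apply: Or32|apply: Or33].
  by move: h; rewrite -mulrA ltr_pM2l.
by move: h; rewrite mulrCA ltr_pM2l.
Qed.

Lemma zero_free_half_disk3 z : half_disk 1 z -> zero_free 3 z.
Proof.
wlog im0 : z / 0 <= complex.Im z.
  move=> H hz; have [im0|im0] := leP 0 (complex.Im z); first exact: H.
  apply: zero_free_conj; apply: H.
  - by case: z im0 {hz} => x y /=; lra.
  - by move: hz; rewrite !half_diskE cnorm_conj; case: z {im0}.
move=> /half_diskE[re0 z1]; have [a ha ->] := polar_repr re0 im0.
by apply: zero_free_cubic => //; rewrite cnorm_ge0.
Qed.

Lemma half_disk_sub_near_domain (d : nat) z : (3 <= d)%N ->
  half_disk (7 / 8 * tan (pi / (2 * d%:R))) z -> near_domain d z.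
Proof.
move=> d3 /half_diskE[_ h]; apply: Or31.
have dt := @mul_tan_div_le R d d3.
by have := ler_wpM2l (ler0n R d) h; lra.
Qed.

Lemma D_eps_sub (d : nat) (e : R) z : (2 <= d)%N -> 0 < e -> D_eps d.+1 e z ->
  [/\ 0 <= complex.Re z, cnorm z < tan (pi / (2 * d%:R)) &
    (3 <= d)%N -> near_domain d z].
Proof.
move=> d2 e0 [/=]; rewrite normCE lecR.
have -> : d.+1%:R - 1 = d%:R :> R by rewrite -addn1 natrD addrK.
have [at_ /andP[t0 t1]] := @atan_tan_div R d d2.
set t : R := tan (pi / (2 * d%:R)) in at_ t0 t1 *.
have dr : 2 <= d%:R :> R by rewrite (ler_nat R 2 d).
have d0 : 0 < d%:R :> R by lra.
have e2 : 0 < 2 + e by lra.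
have p0 := pi_gt0 R.
set x : R := pi / ((2 + e) * d%:R).
have xt : x < pi / (2 * d%:R).
  by rewrite ltr_pM2l// ltf_pV2 ?posrE ?mulr_gt0// ltr_pM2r//; lra.
have x0 : 0 < x by rewrite divr_gt0 ?mulr_gt0.
have xp : pi / (2 * d%:R) < pi / 2 :> R.
  by rewrite ltr_pM2l// ltf_pV2 ?posrE ?mulr_gt0//; lra.
have atx : atan (tan x) = x by rewrite tanK// in_itv /=; apply/andP; split; lra.
have tx : tan x < t.
  by rewrite ltNge; apply/negP => /le_atan; rewrite at_ atx leNgt xt.
move=> zx ze; have zt : cnorm z < t by exact: le_lt_trans tx.
have eE : e * pi / (2 * (2 + e)) = pi / 2 - d%:R * x.
  by rewrite /x; field; rewrite !gt_eqF.
have dx0 : 0 < d%:R * x by rewrite mulr_gt0.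
have [->|z0] := eqVneq z 0.
  split; rewrite /= ?lexx//; first by rewrite /cnorm normr0.
  by move=> _; apply: Or31; rewrite /cnorm normr0 /= mulr0; lra.
have n0 : 0 < cnorm z.
  rewrite lt_neqAle cnorm_ge0 andbT eq_sym; apply: contraNneq z0 => n0.
  by rewrite -normr_eq0 normCE n0.
have [/andP[c0 c1] cE] := carg_cos z0.
have reE : complex.Re z = cnorm z * cos (carg z) by rewrite cE mulrC divfK// gt_eqF.
have re0 : 0 <= complex.Re z.
  by rewrite reE mulr_ge0 ?(ltW n0)// -cos_norm cos_ge0//; lra.
split => // d3.
have [small|large] := ltP (d%:R * cnorm z) (47 / 31); [exact: Or31|apply: Or32].
have dt := @mul_tan_div_le R d d3; rewrite -/t in dt.
have h78 : 7 / 8 * t <= cnorm z.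
  by rewrite -(ler_pM2l d0); lra.
have x78 : 7 / 8 * (pi / (2 * d%:R)) <= x.
  have s1 : 0 <= (7 : R) / 8 <= 1 by lra.
  rewrite -at_; apply: le_trans (atan_scale s1 (ltW t0)) _.
  by rewrite -atx; apply: le_atan; exact: le_trans zx.
have c16 : `|carg z| <= 1 / 4.
  apply: (le_trans ze); rewrite eE; have := pihalf_lt2 R.
  have : 7 / 8 * (pi / 2) <= d%:R * x.
    have -> : 7 / 8 * (pi / 2) = d%:R * (7 / 8 * (pi / (2 * d%:R))) :> R.
      by field; rewrite gt_eqF.
    by rewrite ler_pM2l.
  by lra.
have cosb : 31 / 32 <= cos (carg z).
  apply: le_trans (cos_ge (carg z)); rewrite -[_ ^+ 2]real_normK ?num_real//.
  have : `|carg z| ^+ 2 <= (1 / 4) ^+ 2 by rewrite ler_pXn2r ?nnegrE.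
  by rewrite [(1 / 4) ^+ 2]expr2; lra.
have reb : 31 / 32 * cnorm z <= complex.Re z by rewrite reE mulrC ler_pM2l.
rewrite -(@ltr_pXn2r _ 2) ?nnegrE//; last by rewrite divr_ge0.
rewrite real_normK ?num_real//.
have : (31 / 32 * cnorm z) ^+ 2 <= complex.Re z ^+ 2.
  by rewrite ler_pXn2r ?nnegrE// mulr_ge0// ltW.
have := cnorm_sqr z; have : 0 < cnorm z ^+ 2 by rewrite exprn_gt0.
rewrite exprMn expr_div_n; rewrite !expr2; lra.
Qed.

End ZeroFree.

Section Topology.
Variable R : realType.
Implicit Types (z w : R[i]).

Lemma open_lipschitz (f : R[i] -> R) (k : R) : 0 < k ->
  (forall z w, f w <= f z + k * cnorm (w - z)) ->
  open ([set z | f z < 0] : set R[i]^o).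
Proof.
move=> k0 fk; rewrite openE => z /= fz; rewrite /interior.
have e0 : 0 < - f z / k by rewrite divr_gt0// oppr_gt0.
apply/nbhs_ballP; exists (- f z / k)%:C%C => /=; first by rewrite ltcR.
move=> w; rewrite -ball_normE /ball_ /= -normrN opprB normCE ltcR ltr_pdivlMr// => h.
by have := fk z w; lra.
Qed.

Lemma connected_star (D : set R[i]) : D 0 ->
  (forall z (s : R), D z -> 0 <= s <= 1 -> D (s%:C%C * z)) ->
  connected (D : set R[i]^o).
Proof.
move=> D0 Ds.
have -> : D = \bigcup_(z in D) ((fun s : R => (s%:C%C * z : R[i]^o)) @` `[0, 1]).
  apply/seteqP; split => [z Dz|z [w Dw [s + <-]]].
    exists z => //; exists 1; first by rewrite /= in_itv /= ler01 lexx.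
    by rewrite rmorph1 mul1r.
  by rewrite /= in_itv /= => s01; exact: Ds.
apply: bigcup_connected.
  exists 0 => z _; exists 0; first by rewrite /= in_itv /= ler01 lexx.
  by rewrite rmorph0 mul0r.
move=> z _; apply: connected_continuous_connected; first exact: segment_connected.
apply: continuous_subspaceT => s; apply/cvgrPdist_lt => e e0.
have eR : e = (complex.Re e)%:C%C by case: e e0 => x y; rewrite ltcE /= => /andP[/eqP-> _].
have e1 : 0 < complex.Re e by rewrite eR ltcR in e0.
have c1 : 0 < cnorm z + 1 by rewrite ltr_wpDl// cnorm_ge0.
have d0 : 0 < complex.Re e / (cnorm z + 1) by rewrite divr_gt0.
near=> u.
have : `|s - u| < complex.Re e / (cnorm z + 1).
  by near: u; exact: (@cvgr_dist_lt _ R^o _ _ _ id s).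
rewrite ltr_pdivlMr// => h.
rewrite -mulrBl -rmorphB eR normCE ltcR cnormM.
apply: le_lt_trans h; rewrite ler_wpM2l//; lra.
Unshelve. all: by end_near. Qed.

End Topology.

Section NearDomain.
Variable R : realType.
Implicit Types (z w : R[i]).

Lemma delta_gt0 (d : nat) : (0 < d)%N -> 0 < delta R d.
Proof.
move=> d0; have dr : 0 < d%:R :> R by rewrite ltr0n.
by rewrite divr_gt0// exprn_gt0// mulr_gt0 ?expR_gt0// divr_gt0// mulr_gt0.
Qed.

Lemma open_near_domain (d : nat) : (0 < d)%N -> open (near_domain d : set R[i]^o).
Proof.
move=> d0; have dr : 0 < d%:R :> R by rewrite ltr0n.
have g0 := @delta_gt0 d d0.
have imD z w : `| `|complex.Im w| - `|complex.Im z| | <= cnorm (w - z).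
  apply: le_trans (ler_dist_dist _ _) _; apply: le_trans (Im_le_cnorm (w - z)).
  by case: z w => ? ? [? ?].
have reD z w : `|complex.Re w - complex.Re z| <= cnorm (w - z).
  by apply: le_trans (Re_le_cnorm (w - z)); case: z w => ? ? [? ?].
have -> : near_domain d = [set z : R[i] | d%:R * cnorm z - 47 / 31 < 0] `|`
    [set z | `|complex.Im z| - complex.Re z / 2 < 0] `|`
    [set z | complex.Re z - delta R d * `|complex.Im z| < 0].
  apply/seteqP; split => z; rewrite /near_domain /=.
    by case=> h; [left; left|left; right|right]; rewrite subr_lt0.
  by case=> [[]|]; rewrite subr_lt0 => h; [exact: Or31|exact: Or32|exact: Or33].
apply: openU; first apply: openU.
- apply: (open_lipschitz dr) => z w.
  have := cnorm_triangle z (w - z); rewrite addrC subrK => /(ler_wpM2l (ltW dr)).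
  by rewrite mulrDr; lra.
- apply: (@open_lipschitz _ _ (3 / 2)) => [|z w]; first lra.
  by have /ler_normlP[_ h1] := imD z w; have /ler_normlP[h2 _] := reD z w; lra.
- apply: (@open_lipschitz _ _ (1 + delta R d)) => [|z w]; first lra.
  have /ler_normlP[h1 _] := imD z w; have /ler_normlP[_ h2] := reD z w.
  have := ler_wpM2l (ltW g0) h1; lra.
Qed.

Lemma near_domain_star (d : nat) z (s : R) : near_domain d z -> 0 <= s <= 1 ->
  near_domain d (s%:C%C * z).
Proof.
move=> nz /andP[s0 s1].
have [->|sn] := eqVneq s 0.
  by apply: Or31; rewrite cnormM normr0 mul0r mulr0; lra.
have sp : 0 < s by rewrite lt_neqAle eq_sym sn.
have -> : near_domain d (s%:C%C * z) <-> [\/ d%:R * (s * cnorm z) < 47 / 31,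
   s * `|complex.Im z| < s * complex.Re z / 2 |
   s * complex.Re z < delta R d * (s * `|complex.Im z|)].
  rewrite /near_domain /= cnormM (ger0_norm s0).
  case: z {nz} => x y /=.
  by rewrite !mul0r subr0 addr0 normrM (ger0_norm s0).
case: nz => h; [apply: Or31|apply: Or32|apply: Or33].
- apply: le_lt_trans h; rewrite ler_wpM2l// ler_piMl//; exact: cnorm_ge0.
- by rewrite -mulrA ltr_pM2l.
- by rewrite mulrCA ltr_pM2l.
Qed.

Lemma domain_in_star (E U : set R[i]) : open (U : set R[i]^o) -> E 0 -> U 0 ->
  (forall z (s : R), E z -> 0 <= s <= 1 -> E (s%:C%C * z)) ->
  (forall z (s : R), U z -> 0 <= s <= 1 -> U (s%:C%C * z)) ->
  domain_in E (U `&` E).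
Proof.
move=> oU E0 U0 Es Us; split; first by exists U.
by apply: connected_star => // z s [Uz Ez] s01; split; [exact: Us|exact: Es].
Qed.

Lemma half_disk_star (r : R) z (s : R) : half_disk r z -> 0 <= s <= 1 ->
  half_disk r (s%:C%C * z).
Proof.
move=> /half_diskE[h1 h2] /andP[s0 s1]; apply/half_diskE; split.
  by case: z h1 {h2} => x y /= h1; rewrite mul0r subr0 mulr_ge0.
rewrite cnormM ger0_norm//; apply: le_trans h2.
by rewrite ler_piMl// cnorm_ge0.
Qed.

End NearDomain.

Unset Implicit Arguments.
Set Strict Implicit.

Theorem theorem1p4 (R : realType) :
  (forall l : R[i], half_disk 1 l -> zero_free 3 l) /\
  (forall Delta : nat, (3 <= Delta)%N ->
    let t : R := tan (pi / (2 * (Delta%:R - 1))) in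
    let D1 : set R[i] := half_disk (7 / 8 * t) in
    let D2 : set R[i] := half_disk t in
    (* D1 `<=` D `<=` D2 rules out D open in the whole plane (0 lies in D1 and
       on the boundary of D2), so D is a domain relative to D2. *)
    exists D : set R[i],
      domain_in D2 D /\
      (forall l : R[i], D l -> zero_free Delta l) /\
      (D1 `<=` D /\ D `<=` D2) /\
      D_PR Delta `<` D /\
      (D (t +i* 0)%C /\ D (0 +i* t)%C /\ D (0 -i* t)%C)).
Proof.
split=> [l|[//|d] d2 t D1 D2]; first exact: zero_free_half_disk3.
have {}d2 : (2 <= d)%N by [].
have tE : t = tan (pi / (2 * d%:R)) by rewrite /t -[d.+1]addn1 natrD addrK.
have [_ /andP[t0 t1]] := @atan_tan_div R d d2; rewrite -tE in t0 t1.
have D2t : [/\ D2 (t +i* 0)%C, D2 (0 +i* t)%C & D2 (0 -i* t)%C].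
  by split; apply/half_diskE; rewrite /= cnormE /= ?sqrrN expr0n /= ?addr0 ?add0r
    sqrtr_sqr ger0_norm ?lexx ?ltW.
have D20 : D2 0 by apply/half_diskE; rewrite /= lexx /cnorm normr0 ltW.
have D12 : D1 `<=` D2.
  move=> z /half_diskE[h1 h2]; apply/half_diskE; split => //.
  by apply: le_trans h2 _; lra.
suff [U [oU U0 Us] [Uzf U1 Ue Ut]] : exists2 U : set R[i],
    [/\ open (U : set R[i]^o), U 0 &
      forall z (s : R), U z -> 0 <= s <= 1 -> U (s%:C%C * z)] &
    [/\ forall z, U z -> D2 z -> zero_free d.+1 z, D1 `<=` U,
      forall e z, 0 < e -> D_eps d.+1 e z -> U z &
      [/\ U (t +i* 0)%C, U (0 +i* t)%C & U (0 -i* t)%C]].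
  exists (U `&` D2); split; first by apply: domain_in_star => //; exact: half_disk_star.
  split; first by move=> z [Uz Dz]; exact: Uzf.
  split; first by split=> [z D1z|z []//]; split; [exact: U1|exact: D12].
  move: Ut D2t => [u1 u2 u3] [v1 v2 v3].
  split; last by split; [|split].
  split.
    move=> z [e /= e0 ze]; split; first exact: Ue ze.
    have [h1 h2 _] := D_eps_sub d2 e0 ze.
    by apply/half_diskE; rewrite h1 tE ltW.
  move/(_ (0 +i* t)%C (conj u2 v2)) => [e /= e0 /(D_eps_sub d2 e0)[_ + _]].
  by rewrite -tE cnormE /= expr0n add0r sqrtr_sqr gtr0_norm// ltxx.
have [d3|d3] := leqP 3 d; last first.
  have dE : d = 2%N by apply/eqP; rewrite eqn_leq d2 -ltnS d3.
  exists setT; first by split => //; exact: openT.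
  split => // z _ /half_diskE[h1 h2]; rewrite dE; apply: zero_free_half_disk3.
  by apply/half_diskE; split=> //; exact: le_trans h2 t1.
exists (near_domain d).
  split; first by apply: open_near_domain; exact: leq_trans d2.
    by apply: Or31; rewrite /cnorm normr0 mulr0; lra.
  by move=> z s; exact: near_domain_star.
split.
- by move=> z Uz Dz; apply: zero_free_near_domain => //; rewrite -tE.
- by move=> z; rewrite /D1 tE; exact: half_disk_sub_near_domain.
- by move=> e z e0 /(D_eps_sub d2 e0)[_ _]; apply.
have dt : 0 < delta R d * t by rewrite mulr_gt0// delta_gt0// (leq_trans _ d2).
split; [apply: Or32|apply: Or33|apply: Or33] => /=.
- by rewrite normr0 divr_gt0.
- by rewrite gtr0_norm.
- by rewrite normrN gtr0_norm.
Qed.
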